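(* Let $0<q<1$, let $\{p_n(z;q)\}_{n\in\mathbb N_0}$ be an odd $q$-Lidstone polynomial sequence of type I with matrix $A_q$, and let $B_q$ be the matrix built from the associated sequence $(\beta_{2n})_n$, as in the context. Let $\{\hat p_n(z;q)\}_{n\in\mathbb N_0}$ be a sequence of polynomials. Put $P_q=[p_0,p_1,\dots]^T$, $\widehat P_q=[\hat p_0,\hat p_1,\dots]^T$, $P_{q,n}=[p_0,\dots,p_n]^T$, $\widehat P_{q,n}=[\hat p_0,\dots,\hat p_n]^T$. Then $\{p_n(z;q)\}_n$ and $\{\hat p_n(z;q)\}_n$ are conjugate odd $q$-Lidstone-type sequences if and only if $$P_q=A_q^2\,\widehat P_q,\qquad \widehat P_q=B_q^2\,P_q,$$ and, for $n\in\mathbb N$, $$P_{q,n}=A_{q,n}^2\,\widehat P_{q,n},\qquad \widehat P_{q,n}=B_{q,n}^2\,P_{q,n}.$$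
   Context: Fix $0<q<1$. Put $[m]_q=\frac{1-q^m}{1-q}$, $[m]_q!=\prod_{j=1}^m[j]_q$, $[0]_q!=1$, and ${n \brack k}_q=\frac{[n]_q!}{[k]_q!\,[n-k]_q!}$ for $0\le k\le n$. $\mathbb N=\{1,2,\dots\}$, $\mathbb N_0=\mathbb N\cup\{0\}$. The Jackson $q$-derivative is $D_qf(z)=\frac{f(qz)-f(z)}{(q-1)z}$ for $z\ne0$ and $D_qf(0)=f'(0)$, so $D_qz^m=[m]_qz^{m-1}$. An odd $q$-Lidstone polynomial sequence of type I (class $q$OLS-I) is a sequence $\{p_n(z;q)\}_{n\in\mathbb N_0}$ of polynomials in $z$ with real coefficients such that $D_q^2p_n(z;q)=[2n+1]_q[2n]_q\,p_{n-1}(z;q)$ for $n\in\mathbb N$, $p_n(0;q)=0$ for $n\in\mathbb N_0$, and $p_0(z;q)=\alpha_0z$ with $\alpha_0\in\mathbb R\setminus\{0\}$. Its associated numerical sequence is $\alpha_{2n}:=D_qp_n(0;q)$, and $p_n(z;q)=\sum_{k=0}^n {2n+1 \brack 2k+1}_q\frac{\alpha_{2(n-k)}}{[2(n-k)+1]_q}z^{2k+1}$. The sequence $(\beta_{2n})_{n\ge0}$ is the unique real sequence with $\sum_{j=0}^n \frac{\beta_{2j}\,\alpha_{2(n-j)}}{[2j+1]_q!\,[2(n-j)+1]_q!}=\delta_{n0}$ for all $n\in\mathbb N_0$. $A_q=[a_{ij}]_{i,j\in\mathbb N_0}$ and $B_q=[b_{ij}]_{i,j\in\mathbb N_0}$ are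 the infinite lower triangular matrices with $a_{ij}={2i+1 \brack 2j+1}_q\frac{\alpha_{2(i-j)}}{[2(i-j)+1]_q}$ and $b_{ij}={2i+1 \brack 2j+1}_q\frac{\beta_{2(i-j)}}{[2(i-j)+1]_q}$ for $i\ge j$ (and $0$ for $i<j$); $A_{q,n},B_{q,n}$ are their leading principal submatrices with indices $0\le i,j\le n$. Products of infinite lower triangular matrices (with each other or with column vectors) are well defined by finite sums. The sequence $\{\hat p_n\}_n$ is said to be conjugate to $\{p_n\}_n$ (the two are conjugate odd $q$-Lidstone-type sequences) if $\hat p_n(z;q)=\sum_{k=0}^n {2n+1 \brack 2k+1}_q\frac{\beta_{2(n-k)}}{[2(n-k)+1]_q}z^{2k+1}$ for all $n\in\mathbb N_0$. *)

(* Defs.v *)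
From HB Require Import structures.
From mathcomp Require Import all_boot all_order all_algebra.
From mathcomp Require Import all_classical all_reals all_analysis.
Import Order.TTheory GRing.Theory Num.Theory.
Import numFieldNormedType.Exports.

Set Implicit Arguments.
Unset Strict Implicit.
Unset Printing Implicit Defensive.

Local Open Scope ring_scope.

Definition qnum (R : realType) (q : R) (m : nat) : R :=
  (1 - q ^+ m) / (1 - q).

Definition qfact (R : realType) (q : R) (m : nat) : R :=
  \prod_(1 <= j < m.+1) qnum q j.

(* Meaningful for k <= n only, since n - k is truncated. *)
Definition qbinom (R : realType) (q : R) (n k : nat) : R :=
  qfact q n / (qfact q k * qfact q (n - k)).

Definition qderive (R : realType) (q : R) (f : R -> R) : R -> R :=
  fun z => if z == 0 then derive1 f 0
           else (f (q * z) - f z) / ((q - 1) * z).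

Definition OLS_I (R : realType) (q : R) (p : nat -> {poly R}) : Prop :=
  [/\ forall n : nat, (0 < n)%N -> forall z : R,
        qderive q (qderive q (horner (p n))) z
        = qnum q (n.*2.+1) * qnum q n.*2 * (p n.-1).[z],
      forall n : nat, (p n).[0] = 0
    & exists2 a0 : R, a0 != 0 & p 0%N = a0 *: 'X].

(* Sequences indexed by even integers are stored by half-index:
   [assoc_seq q p n] is alpha_{2n}, and similarly for beta. *)
Definition assoc_seq (R : realType) (q : R) (p : nat -> {poly R}) (n : nat) : R :=
  qderive q (horner (p n)) 0.

(* When 0 < q < 1 and alpha 0 != 0, exactly one sequence beta has this property. *)
Definition is_inverse_seq (R : realType) (q : R) (alpha beta : nat -> R) : Prop :=
  forall n : nat,
    \sum_(j < n.+1) beta j * alpha (n - j)%N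
                    / (qfact q (j.*2.+1) * qfact q ((n - j).*2.+1))
    = (n == 0%N)%:R.

Definition lidstone_coef (R : realType) (q : R) (c : nat -> R) (i j : nat) : R :=
  qbinom q (i.*2.+1) (j.*2.+1) * (c (i - j)%N / qnum q ((i - j).*2.+1)).

Definition conjugate_seq (R : realType) (q : R) (beta : nat -> R)
    (phat : nat -> {poly R}) : Prop :=
  forall n : nat,
    phat n = \sum_(k < n.+1) lidstone_coef q beta n k *: 'X^(k.*2.+1).

Definition infmx (R : realType) := nat -> nat -> R.

Definition lidstone_mx (R : realType) (q : R) (c : nat -> R) : infmx R :=
  fun i j => if (j <= i)%N then lidstone_coef q c i j else 0.

(* Row i of a lower triangular matrix vanishes beyond column i, so for a lower
   triangular left factor the sums below contain every nonzero term of the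
   formal infinite sums. *)
Definition infmx_mul (R : realType) (A B : infmx R) : infmx R :=
  fun i j => \sum_(k < i.+1) A i k * B k j.

Definition infmx_act (R : realType) (A : infmx R) (v : nat -> {poly R}) :
    nat -> {poly R} :=
  fun i => \sum_(k < i.+1) A i k *: v k.

Definition leading_mx (R : realType) (A : infmx R) (n : nat) : 'M[R]_n.+1 :=
  \matrix_(i, j) A i j.

Definition leading_col (R : realType) (v : nat -> {poly R}) (n : nat) :
    'cV[{poly R}]_n.+1 :=
  \col_i v i.

(* Main.v *)
(* Write X for the column of odd monomials z^(2k+1).  Comparing coefficients in
   the defining q-difference equation gives P = A X, and conjugacy says that
   Phat = B X.  With q-binomials expanded into q-factorials, the convolution
   identity defining beta becomes A B = B A = 1.  Hence Phat = B X gives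
   A^2 Phat = A (A B) X = P and B^2 P = B (B A) X = Phat, and conversely
   Phat = B^2 P = B (B A) X = B X. *)
Require Import Defs.
From HB Require Import structures.
From mathcomp Require Import all_boot all_order all_algebra.
From mathcomp Require Import all_classical all_reals all_analysis.
From mathcomp Require Import ring.
Import Order.TTheory GRing.Theory Num.Theory.
Import numFieldNormedType.Exports.

Set Implicit Arguments.
Unset Strict Implicit.
Unset Printing Implicit Defensive.

Local Open Scope ring_scope.

(** The naturals below [size (a - b)] are distinct in R, and a nonzero polynomial has fewer roots
    than its size. *)
Lemma poly_ext_horner (R : realType) (a b : {poly R}) :
  (forall z, a.[z] = b.[z]) -> a = b.
Proof.
move=> ab; apply/eqP; rewrite -subr_eq0; apply/negPn/negP => ab_neq0.
pose s : seq R := [seq i%:R | i <- iota 0 (size (a - b))].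
have root_s : all (root (a - b)) s.
  by apply/allP => z _; rewrite rootE hornerD hornerN ab subrr.
have uniq_s : uniq s.
  by rewrite map_inj_uniq ?iota_uniq // => i j /eqP; rewrite eqr_nat => /eqP.
by have := max_poly_roots ab_neq0 root_s uniq_s; rewrite size_map size_iota ltnn.
Qed.

(** * The q-derivative on polynomials and the coefficients of [p n] *)

Section QDerivative.
Variables (R : realType) (q : R).
Hypotheses (hq0 : 0 < q) (hq1 : q < 1).

Lemma qnum_gt0 m : (0 < m)%N -> 0 < qnum q m.
Proof.
by move=> m_gt0; rewrite divr_gt0 // subr_gt0 // exprn_ilt1 ?ltW // -lt0n.
Qed.

Lemma qnum_neq0 m : qnum q m.+1 != 0.
Proof. by rewrite gt_eqF ?qnum_gt0. Qed.

Lemma qnum1 : qnum q 1 = 1.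
Proof. by rewrite /qnum expr1 divff // gt_eqF // subr_gt0. Qed.

Lemma qfact0 : qfact q 0 = 1.
Proof. by rewrite /qfact big_geq. Qed.

Lemma qfactS m : qfact q m.+1 = qfact q m * qnum q m.+1.
Proof. by rewrite /qfact big_nat_recr. Qed.

Lemma qfact1 : qfact q 1 = 1.
Proof. by rewrite qfactS qfact0 qnum1 mulr1. Qed.

Lemma qfact_neq0 m : qfact q m != 0.
Proof.
by elim: m => [|m IHm]; rewrite ?qfact0 ?oner_neq0 // qfactS mulf_neq0 ?qnum_neq0.
Qed.

Definition qderiv_poly (a : {poly R}) : {poly R} :=
  \poly_(i < (size a).-1) (qnum q i.+1 * a`_i.+1).

Lemma coef_qderiv_poly a i : (qderiv_poly a)`_i = qnum q i.+1 * a`_i.+1.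
Proof.
rewrite coef_poly; case: ltnP => // le_a_i.
by rewrite [a`_i.+1]nth_default ?mulr0 // (leq_trans (leqSpred _)).
Qed.

(** For z nonzero, (qz)^(i+1) - z^(i+1) = (q-1) z [i+1]_q z^i termwise; at 0 both sides are the
    coefficient of z, because [1]_q = 1. *)
Lemma qderive_horner a z : qderive q (horner a) z = (qderiv_poly a).[z].
Proof.
rewrite /qderive; case: eqVneq => [->|z_neq0].
  by rewrite -derivE !horner_coef0 coef_deriv coef_qderiv_poly qnum1 mul1r.
have q1 : q - 1 != 0 by rewrite subr_eq0 lt_eqF.
apply: (canLR (mulfK (mulf_neq0 q1 z_neq0))).
(* Widening to a successor lets the constant term, which cancels in a(qz) - a(z), be split off even
   when a = 0. *)
have le_a : (size a <= (size a).-1.+1)%N by exact: leqSpred.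
rewrite !(horner_coef_wide _ le_a).
rewrite -sumrB big_ord_recl !expr0 subrr add0r.
rewrite (horner_coef_wide _ (size_poly _ _)) mulr_suml.
apply: eq_bigr => i _; rewrite coef_qderiv_poly /= /bump /= add1n.
rewrite /qnum exprMn [z ^+ _]exprS; field.
by rewrite subr_eq0 gt_eqF.
Qed.

Lemma assoc_seqE (p : nat -> {poly R}) n : assoc_seq q p n = (p n)`_1.
Proof.
by rewrite /assoc_seq qderive_horner horner_coef0 coef_qderiv_poly qnum1 mul1r.
Qed.

(** The denominator [2(i-j)+1]_q completes [2(i-j)]_q! to a factorial. What remains is a factor in
    i, a factor in j and a factor in i - j, so matrix products become convolutions. *)
Lemma lidstone_coefE c i j : lidstone_coef q c i j =
  qfact q i.*2.+1 / qfact q j.*2.+1 * (c (i - j)%N / qfact q (i - j).*2.+1).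
Proof.
rewrite /lidstone_coef /qbinom subSS -doubleB [qfact q (i - j).*2.+1]qfactS.
by field; rewrite qnum_neq0 !qfact_neq0.
Qed.

Lemma OLS_I_coef_rec p : OLS_I q p -> forall n m,
  qnum q m.+1 * (qnum q m.+2 * (p n.+1)`_m.+2) =
  qnum q n.+1.*2.+1 * qnum q n.+1.*2 * (p n)`_m.
Proof.
case=> p_rec _ _ n m; rewrite -!coef_qderiv_poly -coefZ; congr ((polyseq _)`_m).
apply: poly_ext_horner => z; rewrite hornerZ -(p_rec n.+1) // -qderive_horner.
by congr (qderive _ _ z); apply/funext => y; rewrite qderive_horner.
Qed.

(** Induction on n: the recurrence passes from coefficient m of [p n] to coefficient m+2 of
    [p n.+1]. The two remaining coefficients are initial data: the constant one vanishes and the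
    linear one is the associated number. *)
Lemma OLS_I_coef p : OLS_I q p -> forall n m, (p n)`_m =
  if odd m && (m <= n.*2.+1)%N then lidstone_coef q (assoc_seq q p) n m./2 else 0.
Proof.
move=> hp; have [_ p0 [a0 _ p_0]] := hp.
elim=> [|n IHn] m.
  rewrite p_0 coefZ coefX; case: m => [|[|m]]; rewrite ?mulr0 ?andbF //=.
  rewrite lidstone_coefE subn0 assoc_seqE p_0 coefZ coefX /= qfact1.
  by rewrite !divr1 !mul1r.
case: m => [|[|m]]; first by rewrite -horner_coef0 p0.
  rewrite /= lidstone_coefE subn0 assoc_seqE qfact1 divr1 mulrCA.
  by rewrite divff ?mulr1 ?qfact_neq0.
apply: (mulfI (qnum_neq0 m.+1)); apply: (mulfI (qnum_neq0 m)).
rewrite OLS_I_coef_rec // IHn /= negbK doubleS !ltnS.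
case: ifP => [/andP[odd_m le_m]|_]; last by rewrite !mulr0.
have m_eq : m./2.*2.+1 = m by rewrite -[RHS]odd_double_half odd_m.
rewrite !lidstone_coefE subSS !doubleS m_eq.
rewrite [qfact q n.*2.+3]qfactS [qfact q n.*2.+2]qfactS.
rewrite [qfact q m.+2]qfactS [qfact q m.+1]qfactS.
by field; rewrite !qnum_neq0 !qfact_neq0.
Qed.

Definition odd_monomial (k : nat) : {poly R} := 'X^(k.*2.+1).

Lemma coef_odd_monomial_sum (c : nat -> R) n m :
  (\sum_(k < n.+1) c k *: odd_monomial k)`_m =
  if odd m && (m <= n.*2.+1)%N then c m./2 else 0.
Proof.
rewrite coef_sum; under eq_bigr => k _ do rewrite coefZ coefXn.
case: ifP => [/andP[odd_m le_m]|m_out].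
  have lt_m : (m./2 < n.+1)%N.
    by rewrite ltnS leq_half_double.
  have m_eq : m./2.*2.+1 = m by rewrite -[RHS]odd_double_half odd_m.
  rewrite (bigD1 (Ordinal lt_m)) //= m_eq eqxx mulr1 big1 ?addr0 // => k.
  rewrite -val_eqE /= => k_neq; case: eqP => [m_k|]; last by rewrite mulr0.
  by rewrite m_k /= uphalf_double eqxx in k_neq.
apply: big1 => k _; case: eqP => [m_k|]; last by rewrite mulr0.
by rewrite m_k /= odd_double /= ltnS leq_double -ltnS ltn_ord in m_out.
Qed.

Lemma OLS_I_expansion p : OLS_I q p ->
  p =1 infmx_act (lidstone_mx q (assoc_seq q p)) odd_monomial.
Proof.
move=> hp n; apply/polyP => m; rewrite coef_odd_monomial_sum OLS_I_coef //.
case: ifP => // /andP[_ le_m]; rewrite /lidstone_mx.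
by rewrite leq_half_double le_m.
Qed.

Lemma conjugate_seqE beta phat :
  conjugate_seq q beta phat <->
  phat =1 infmx_act (lidstone_mx q beta) odd_monomial.
Proof.
have E n : infmx_act (lidstone_mx q beta) odd_monomial n =
    \sum_(k < n.+1) lidstone_coef q beta n k *: 'X^(k.*2.+1).
  by apply: eq_bigr => k _; rewrite /lidstone_mx -ltnS ltn_ord.
by split=> h n; rewrite h E.
Qed.

End QDerivative.

(** * Lower triangular infinite matrices and their leading blocks *)

Section LowerTriangular.
Variable R : realType.
Implicit Types (A B : infmx R) (v w : nat -> {poly R}).

Definition lower_triangular A := forall i j, (i < j)%N -> A i j = 0.

(** Reconciles sums that stop at the diagonal with sums of a fixed length. A general module V covers
    both matrix entries and polynomial columns. *)
Lemma infmx_sum_widen A (V : lmodType R) (f : nat -> V) i n :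
  lower_triangular A -> (i <= n)%N ->
  \sum_(k < n.+1) A i k *: f k = \sum_(k < i.+1) A i k *: f k.
Proof.
move=> A_lower le_in; rewrite -!(big_mkord xpredT (fun k => A i k *: f k)).
rewrite (big_cat_nat (n := i.+1)) //= [X in _ + X]big_nat_cond [X in _ + X]big1 ?addr0 //.
by move=> k /andP[/andP[lt_ik _] _]; rewrite A_lower ?scale0r.
Qed.

Lemma infmx_mul_lower A B :
  lower_triangular A -> lower_triangular B -> lower_triangular (infmx_mul A B).
Proof.
move=> A_lower B_lower i j lt_ij; apply: big1 => k _.
by rewrite B_lower ?mulr0 // (leq_ltn_trans _ lt_ij) // -ltnS.
Qed.

Lemma eq_infmx_act A v w : v =1 w -> infmx_act A v =1 infmx_act A w.
Proof. by move=> vw i; apply: eq_bigr => k _; rewrite vw. Qed.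

(** Once the inner sums are widened to the common length i+1, the two summations can be
    exchanged. *)
Lemma infmx_act_mul A B v : lower_triangular B ->
  infmx_act (infmx_mul A B) v =1 infmx_act A (infmx_act B v).
Proof.
move=> B_lower i; rewrite /infmx_act /infmx_mul.
under eq_bigr => k _ do rewrite scaler_suml.
rewrite exchange_big; apply: eq_bigr => l _ /=.
rewrite -(@infmx_sum_widen _ _ v _ i) // -1?ltnS // scaler_sumr.
by apply: eq_bigr => k _; rewrite scalerA.
Qed.

(** The action never reads entries above the diagonal, so nothing is asked of them. *)
Lemma infmx_act_id A v : (forall i j, (j <= i)%N -> A i j = (i == j)%:R) ->
  infmx_act A v =1 v.
Proof.
move=> A_id i; rewrite /infmx_act big_ord_recr /= A_id // eqxx scale1r big1 ?add0r //.
by move=> k _; rewrite A_id ?gtn_eqF ?scale0r // ltnW.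
Qed.

Lemma leading_mx_mul A B n : lower_triangular A ->
  leading_mx (infmx_mul A B) n = leading_mx A n *m leading_mx B n.
Proof.
move=> A_lower; apply/matrixP => i j; rewrite !mxE.
under [RHS]eq_bigr => k _ do rewrite !mxE.
(* Over the regular module [R^o], scaling is multiplication in R. *)
by rewrite (@infmx_sum_widen A R^o (B^~ j)) // -ltnS.
Qed.

Lemma leading_col_act A v n : lower_triangular A ->
  leading_col (infmx_act A v) n = map_mx polyC (leading_mx A n) *m leading_col v n.
Proof.
move=> A_lower; apply/matrixP => i j; rewrite !mxE.
under [RHS]eq_bigr => k _ do rewrite !mxE mul_polyC.
by rewrite infmx_sum_widen // -ltnS.
Qed.

Lemma leading_col_act_sqr A v w n : lower_triangular A ->
  w =1 infmx_act (infmx_mul A A) v ->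
  leading_col w n = map_mx polyC (leading_mx A n ^+ 2) *m leading_col v n.
Proof.
move=> A_lower w_eq; rewrite expr2 -[_ * _]leading_mx_mul //.
rewrite -leading_col_act; last exact: infmx_mul_lower.
by apply/matrixP => i j; rewrite !mxE w_eq.
Qed.

End LowerTriangular.

(** * Inverse sequences yield inverse matrices *)

Section InverseSequences.
Variables (R : realType) (q : R).
Hypotheses (hq0 : 0 < q) (hq1 : q < 1).

Lemma lidstone_mx_lower c : lower_triangular (lidstone_mx q c).
Proof. by move=> i j lt_ij; rewrite /lidstone_mx leqNgt lt_ij. Qed.

Lemma is_inverse_seq_sym (a b : nat -> R) : is_inverse_seq q a b -> is_inverse_seq q b a.
Proof.
move=> ab n; rewrite -ab (reindex_inj rev_ord_inj) /=.
apply: eq_bigr => j _; rewrite subSS subKn; last by rewrite -ltnS.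
by rewrite [a _ * _]mulrC [qfact q _ * _]mulrC.
Qed.

(** The factorials of the summation index cancel, leaving [2i+1]_q! / [2j+1]_q! times the defining
    convolution at i - j. *)
Lemma lidstone_mx_mul (a b : nat -> R) : is_inverse_seq q a b -> forall i j,
  (j <= i)%N -> infmx_mul (lidstone_mx q a) (lidstone_mx q b) i j = (i == j)%:R.
Proof.
move=> ab i j le_ji.
have fact_neq0 := qfact_neq0 hq0 hq1.
(* The prefactor is harmless: it equals 1 on the diagonal, and elsewhere the delta vanishes. *)
transitivity (qfact q i.*2.+1 / qfact q j.*2.+1 * (i - j == 0)%N%:R); last first.
  rewrite subn_eq0 eqn_leq le_ji andbT; case: leqP => [le_ij|_]; last by rewrite mulr0.
  have -> : i = j by apply/eqP; rewrite eqn_leq le_ij.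
  by rewrite divff ?mulr1.
rewrite -ab mulr_sumr /infmx_mul.
rewrite -(big_mkord xpredT (fun k => lidstone_mx q a i k * lidstone_mx q b k j)).
(* Terms with k < j vanish by triangularity of the right factor; shifting the others by j gives the
   convolution. *)
rewrite (big_cat_nat (n := j)) //=; last exact: leqW.
rewrite [X in X + _]big_nat_cond [X in X + _]big1 ?add0r; last first.
  by move=> k /andP[/andP[_ lt_kj] _]; rewrite [lidstone_mx q b _ _]lidstone_mx_lower ?mulr0.
rewrite -{1}[j]add0n big_addn subSn // big_mkord.
apply: eq_bigr => k _.
have le_k : (k + j <= i)%N by rewrite addnC -leq_subRL // -ltnS.
rewrite /lidstone_mx le_k leq_addl !(lidstone_coefE hq0 hq1) addnK.
by rewrite addnC subnDA; field; rewrite !fact_neq0.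
Qed.

End InverseSequences.

Theorem proposition2p14 (R : realType) (q : R) (hq0 : 0 < q) (hq1 : q < 1)
  (p : nat -> {poly R}) (hp : OLS_I q p)
  (beta : nat -> R) (hbeta : is_inverse_seq q (assoc_seq q p) beta)
  (phat : nat -> {poly R}) :
  let A := lidstone_mx q (assoc_seq q p) in
  let B := lidstone_mx q beta in
  conjugate_seq q beta phat <->
  [/\ p =1 infmx_act (infmx_mul A A) phat,
      phat =1 infmx_act (infmx_mul B B) p
    & forall n : nat, (0 < n)%N ->
        leading_col p n
          = map_mx polyC (leading_mx A n ^+ 2) *m leading_col phat n
        /\ leading_col phat n
          = map_mx polyC (leading_mx B n ^+ 2) *m leading_col p n].
Proof.
move=> A B.
have A_lower : lower_triangular A by exact: lidstone_mx_lower.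
have B_lower : lower_triangular B by exact: lidstone_mx_lower.
have AB_id v : infmx_act A (infmx_act B v) =1 v.
  move=> i; rewrite -infmx_act_mul // infmx_act_id //; exact: lidstone_mx_mul.
have BA_id v : infmx_act B (infmx_act A v) =1 v.
  move=> i; rewrite -infmx_act_mul // infmx_act_id //.
  exact/(lidstone_mx_mul hq0 hq1)/is_inverse_seq_sym.
have pE : p =1 infmx_act A (@odd_monomial R) by exact: OLS_I_expansion.
rewrite conjugate_seqE; split=> [phatE|[_ phatE _] n]; last first.
  rewrite phatE infmx_act_mul //; apply: eq_infmx_act => i.
  by rewrite (eq_infmx_act _ pE) BA_id.
have p_eq : p =1 infmx_act (infmx_mul A A) phat.
  move=> n; rewrite pE infmx_act_mul //; apply: eq_infmx_act => i.
  by rewrite (eq_infmx_act _ phatE) AB_id.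
have phat_eq : phat =1 infmx_act (infmx_mul B B) p.
  move=> n; rewrite phatE infmx_act_mul //; apply: eq_infmx_act => i.
  by rewrite (eq_infmx_act _ pE) BA_id.
(* The block identities are truncations of the two infinite ones. *)
by split=> // n _; split; exact: leading_col_act_sqr.
Qed.
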